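(* Let $R$ be a commutative ring with identity, $\sigma$ a finite linearly ordered index set, and $K$ a commutative $R$-algebra, in which zeros are taken. For every finite set $PS=(p_1,\ldots,p_s)$ of polynomials in $R[X_i]_{i\in\sigma}$, a characteristic set $CS=(c_1,\ldots,c_t)$ of $PS$ can be constructed in a finite number of steps using the following algorithm: 1. Set $PS':=PS$. 2. Set $RS:=\emptyset$ and let $BS$ be a basic set of $PS'$. 3. For each $p\in PS'$, compute $r:=\operatorname{remdr}(p/BS)$, and if $r\neq 0$ set $RS:=RS\cup\{r\}$. 4. Set $PS':=PS\cup RS\cup BS$. 5. If $RS=\emptyset$, stop and return $CS:=BS$; otherwise go to step 2.
   Context: Variables are ordered by $X_i<X_j$ whenever $i<j$. The main variable of a nonconstant $p\in R[X_i]_{i\in\sigma}$ is the greatest variable $X_{m_p}$ appearing in $p$; for constants put $m_p=\bot$, smaller than every element of $\sigma$. $\deg_i(p)$ is the degree of $p$ in $X_i$ (with $\deg_i(0)=0$); the main degree $\deg(p)$ is $\deg_{m_p}(p)$, and $0$ for constants. Initial: for nonconstant $p$ with main variable $X_i$, the initial $I_p=\operatorname{init}(p)$ is the leading coefficient of $p$ viewed as a polynomial in $X_i$; $\operatorname{init}(0)=0$, and the initial of a nonzero constant is $1$. For any $i\in\sigma$, $\operatorname{init}_i(r)$ denotes the coefficient of $X_i^{\deg_i(r)}$ in $r$ viewed as a polynomial in $X_i$. Order on nonzero polynomials: $p\prec q$ iff $m_p<m_q$, or $m_p=m_q$ and $\deg(p)<\deg(q)$; $p\sim q$ iff neither $p\prec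 q$ nor $q\prec p$. Reduced: $q$ is reduced with respect to a nonconstant $p$ with main variable $X_m$ if $q=0$ or $\deg_m(q)<\deg(p)$. The zero polynomial is reduced with respect to every polynomial; no nonzero polynomial is reduced with respect to a constant. Triangular set: a finite set of nonzero polynomials (possibly empty) that can be arranged as $s_1,\ldots,s_r$ with strictly increasing main-variable indices ($s_1$ may be a nonzero constant). For triangular sets $S=(s_1,\ldots,s_r)$, $S'=(s'_1,\ldots,s'_{r'})$: $S\prec S'$ iff either there is $k\le\min(r,r')$ with $s_i\sim s'_i$ for $i<k$ and $s_k\prec s'_k$, or $r>r'$ and $s_i\sim s'_i$ for all $1\le i\le r'$. $S\sim S'$ iff neither $S\prec S'$ nor $S'\prec S$; $S\preceq S'$ iff $S\prec S'$ or $S\sim S'$. Ascending set: a triangular set $(as_1,\ldots,as_r)$ such that $as_j$ is reduced with respect to $as_i$ for all $i<j$. Basic set of a set $P$ of polynomials: a minimal ascending set contained in $P$, i.e. an ascending set $B\subseteq P$ with $B\preceq S$ for every ascending set $S\subseteq P$. Pseudo-remainder: for $f$ nonconstant with main variable $X_m$, $\operatorname{remdr}(g/f)$ is obtained by starting with $r:=g$ and, as long as $\deg_m(r)\ge\deg_m(f)$, replacing $r$ by $\operatorname{init}(f)\,r-\operatorname{init}_m(r)X_m^{\deg_m(r)-\deg_m(f)}f$; for a nonzero constant $f$, $\operatorname{remdr}(g/f)=0$. For a triangular set $S=(s_1,\ldots,s_k)$, $\operatorname{remdr}(g/S)$ is obtained by successive pseudo-division: $r_k=\operatorname{remdr}(g/s_k)$,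 then $r_{k-1}=\operatorname{remdr}(r_k/s_{k-1})$, and so on down to $s_1$; the final remainder is $\operatorname{remdr}(g/S)$ (it is $g$ if $S$ is empty). Zero sets: for a set $P$ of polynomials, $\operatorname{Zero}(P)\subseteq K^\sigma$ is the set of common zeros in $K^\sigma$ of all elements of $P$ (evaluated via the $R$-algebra structure of $K$). Characteristic set: a triangular set $CS$ is a characteristic set of $PS$ if (1) $\operatorname{remdr}(p/CS)=0$ for every $p\in PS$, and (2) $\operatorname{Zero}(PS)\subseteq\operatorname{Zero}(CS)$. *)

(* Defs.v *)
(* R[X_i]_{i \in sigma} is {malg R[{cmonom sigma}]}. *)
From HB Require Import structures.
From mathcomp Require Import all_boot all_order all_algebra.
From mathcomp Require Import finmap.
From mathcomp.multinomials Require Import monalg.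

Set Implicit Arguments.
Unset Strict Implicit.
Unset Printing Implicit Defensive.

Import Order.TTheory GRing.Theory.

Local Open Scope fset_scope.
Local Open Scope ring_scope.

Section Polynomials.
Context {d : Order.disp_t} {sigma : finOrderType d} {R : comPzRingType}.

Local Notation poly := {malg R[{cmonom sigma}]}.
Implicit Types (p q f g r : poly) (i j : sigma) (S T B : seq poly).

(* The library only multiplies in {malg R[_]} when 1 != 0 in R; this is the   *)
(* same formula, without that restriction (see pmulE below).                  *)
Definition pmul p q : poly :=
  \sum_(m1 <- msupp p) \sum_(m2 <- msupp q)
    << p@_m1 * q@_m2 *g mmul m1 m2 >>.

Definition deg_in i p : nat := \max_(m <- msupp p) (m : {cmonom sigma}) i.

Definition appears_in i p : bool :=
  has (fun m : {cmonom sigma} => m i != 0%N) (msupp p).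

(* None encodes \bot. *)
Definition main_var p : option sigma :=
  [pick i | appears_in i p & [forall j, appears_in j p ==> (j <= i)%O]].

Definition var_lt (a b : option sigma) : bool :=
  match a, b with
  | _, None => false
  | None, Some _ => true
  | Some i, Some j => (i < j)%O
  end.

Definition main_deg p : nat :=
  if main_var p is Some i then deg_in i p else 0%N.

Definition erase_var i (m : {cmonom sigma}) : {cmonom sigma} :=
  [cmonom (if j == i then 0%N else m j) | j in finsupp m]%M.

Definition init_in i p : poly :=
  \sum_(m <- msupp p | (m : {cmonom sigma}) i == deg_in i p)
    << p@_m *g erase_var i m >>.

Definition init p : poly :=
  if main_var p is Some i then init_in i p
  else if p == 0 then 0 else (1 : R)%:MP.

Definition poly_lt p q : bool :=
  var_lt (main_var p) (main_var q)
  || (main_var p == main_var q) && (main_deg p < main_deg q)%N.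

Definition poly_sim p q : bool := ~~ poly_lt p q && ~~ poly_lt q p.

Definition reduced q p : bool :=
  (q == 0) || (if main_var p is Some i then (deg_in i q < main_deg p)%N
               else false).

(* A triangular set is given by its (unique) arrangement s_1, ..., s_r. *)
Definition triangular S : bool :=
  all (fun p => p != 0) S && sorted (relpre main_var var_lt) S.

Definition tri_lt S T : Prop :=
  (exists k, [/\ (k < minn (size S) (size T))%N,
     forall l, (l < k)%N -> poly_sim S`_l T`_l & poly_lt S`_k T`_k])
  \/ ((size T < size S)%N /\
      forall l, (l < size T)%N -> poly_sim S`_l T`_l).

Definition tri_sim S T : Prop := ~ tri_lt S T /\ ~ tri_lt T S.

Definition tri_le S T : Prop := tri_lt S T \/ tri_sim S T.

Definition ascending S : bool :=
  triangular S && pairwise (fun p q => reduced q p) S.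

Definition basic_set (P : {fset poly}) B : Prop :=
  [/\ ascending B, {subset B <= P} &
      forall S, ascending S -> {subset S <= P} -> tri_le B S].

Definition pdiv_step i f r : poly :=
  pmul (init f) r
  - pmul (pmul (init_in i r)
               << (1 : R) *g expcmn (ucm i) (deg_in i r - deg_in i f) >>) f.

(* The while loop of pseudo-division: while its guard holds, the leading      *)
(* terms in X_i cancel, so deg_in i strictly decreases, and                   *)
(* (deg_in i g).+1 guarded iterations reach its exit.                         *)
(* The value at f = 0 is irrelevant: triangular sets do not contain 0.        *)
Definition remdr g f : poly :=
  if main_var f is Some i then
    iter (deg_in i g).+1
      (fun r => if (deg_in i f <= deg_in i r)%N then pdiv_step i f r else r) g
  else 0.

(* foldr divides by the last element of S first. *)
Definition remdr_seq g S : poly := foldr (fun s r => remdr r s) g S.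

(* One pass through the algorithm: P is the current value of PS', B the basic *)
(* set chosen in P.                                                           *)
Definition remainders (P : {fset poly}) B : {fset poly} :=
  [fset remdr_seq p B | p in P] `\ 0.

Definition cs_step (PS P Q : {fset poly}) : Prop :=
  exists B, [/\ basic_set P B, remainders P B != fset0 &
    Q = PS `|` remainders P B `|` [fset b in B]].

Inductive cs_reaches (PS : {fset poly}) : {fset poly} -> Prop :=
| cs_start : cs_reaches PS PS
| cs_loop P Q : cs_reaches PS P -> cs_step PS P Q -> cs_reaches PS Q.

Definition cs_returns (PS : {fset poly}) (CS : seq poly) : Prop :=
  exists P, [/\ cs_reaches PS P, basic_set P CS & remainders P CS = fset0].

End Polynomials.

Section Zeros.
Context {d : Order.disp_t} {sigma : finOrderType d} {R K : comPzRingType}.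
(* The R-algebra structure of K. *)
Context (iota : {rmorphism R -> K}).

Local Notation poly := {malg R[{cmonom sigma}]}.

Definition peval (x : sigma -> K) (p : poly) : K :=
  \sum_(m <- msupp p)
    iota p@_m * \prod_(i : sigma) x i ^+ (m : {cmonom sigma}) i.

Definition is_zero (P : {pred poly}) (x : sigma -> K) : Prop :=
  forall p, p \in P -> peval x p = 0.

Definition characteristic_set (PS : {fset poly}) (CS : seq poly) : Prop :=
  [/\ triangular CS,
      forall p, p \in PS -> remdr_seq p CS = 0 &
      forall x, is_zero [in PS] x -> is_zero [in CS] x].

End Zeros.

Lemma pmulE d (sigma : finOrderType d) (R : comNzRingType)
  (p q : {malg R[{cmonom sigma}]}) : pmul p q = p * q.
Proof. by []. Qed.

(* Main.v *)
(* Let r <> 0 be a remainder of some p modulo a basic set B of PS'. It is     *)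
(* reduced with respect to every element of B, so the elements of B whose     *)
(* main variable is below that of r, followed by r, form an ascending set     *)
(* strictly below B. It lies in the next PS', whose basic sets are therefore  *)
(* strictly below B. Triangular sets have at most |sigma| + 1 elements, so    *)
(* their order embeds into a lexicographic order on sequences of naturals of  *)
(* bounded length, which is well-founded. For the zeros, remdr(p/B) vanishes  *)
(* wherever p and B do, so Zero(PS) stays inside Zero(PS').                   *)
Require Import Defs.
From Stdlib Require Import Classical.
From mathcomp Require Import all_boot all_order all_algebra.
From mathcomp Require Import finmap.
From mathcomp.multinomials Require Import monalg.

Set Implicit Arguments.
Unset Strict Implicit.
Unset Printing Implicit Defensive.

Import Order.TTheory GRing.Theory.

Local Open Scope fset_scope.
Local Open Scope ring_scope.

(** The drop at each pass is [cs_step_tri_lt]. It combines two facts: a pseudo-remainder is reduced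
    with respect to every divisor ([reduced_remdr_seq]), and a nonzero polynomial reduced with
    respect to an ascending set can be inserted so as to lower that set ([ascending_insert]). The
    map [profile] makes the order on sets a lexicographic one ([tri_ltE]), well-founded on ascending
    sets ([tri_lt_wf]); this gives both the existence of basic sets ([basic_set_exists]) and
    termination ([cs_step_acc]). At exit, every [PS'] contains [PS] ([cs_reaches_sub]), so an empty
    set of remainders is condition (1); condition (2) is [cs_reaches_zero] applied to [CS], which
    lies in the last [PS']. *)

(** * Additive functions of a polynomial defined monomial by monomial *)

Section MonomialSums.
Context (M : choiceType) (G V : zmodType) (h : M -> G -> V).
Hypothesis hD : forall m, {morph h m : a b / a + b}.

(** Both [pmul] and [peval] have this shape, so their additivity comes from a single argument. *)
Definition msum (p : {malg G[M]}) : V := \sum_(m <- msupp p) h m p@_m.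

Let h0 m : h m 0 = 0.
Proof. by apply: (addrI (h m 0)); rewrite -hD !addr0. Qed.

Lemma msumEw (E : {fset M}) (p : {malg G[M]}) :
  msupp p `<=` E -> msum p = \sum_(m <- E) h m p@_m.
Proof.
move=> pE; rewrite /msum (big_fset_incl _ pE) // => m _.
by case: msuppP.
Qed.

Lemma msum0 : msum 0 = 0.
Proof. by rewrite /msum msupp0 big_seq_fset0. Qed.

Lemma msumD : {morph msum : p q / p + q}.
Proof.
move=> p q; rewrite (msumEw (msuppD_le p q)).
rewrite (msumEw (fsubsetUl (msupp p) (msupp q))).
rewrite (msumEw (fsubsetUr (msupp p) (msupp q))) -big_split /=.
by apply: eq_bigr => m _; rewrite mcoeffD hD.
Qed.

Lemma msumB : {morph msum : p q / p - q}.
Proof. by move=> p q; apply: (addIr (msum q)); rewrite -msumD !subrK. Qed.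

Lemma msum_sum (I : Type) (r : seq I) (P : pred I) (F : I -> {malg G[M]}) :
  msum (\sum_(i <- r | P i) F i) = \sum_(i <- r | P i) msum (F i).
Proof. exact: (big_morph _ msumD msum0). Qed.

Lemma msumU m c : msum << c *g m >> = h m c.
Proof. by rewrite (msumEw (@msuppU_le _ _ m c)) big_seq_fset1 mcoeffUU. Qed.

End MonomialSums.

(** * Products, degrees and pseudo-division *)

Section Reduction.
Context {d : Order.disp_t} {sigma : finOrderType d} {R : comPzRingType}.
Local Notation poly := {malg R[{cmonom sigma}]}.
Implicit Types (p q f g r : poly) (i j : sigma) (S T B : seq poly)
  (m : {cmonom sigma}).

Let rterm (a : R) m n (c : R) : poly := << a * c *g mmul m n >>.
Let lterm q m (c : R) : poly := \sum_(n <- msupp q) << c * q@_n *g mmul m n >>.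

Let rtermD a m n : {morph rterm a m n : b c / b + c}.
Proof. by move=> b c; rewrite /rterm mulrDr monalgUD. Qed.

Let ltermD q m : {morph lterm q m : b c / b + c}.
Proof.
move=> b c; rewrite /lterm -big_split /=.
by apply: eq_bigr => n _; rewrite mulrDl monalgUD.
Qed.

Let ltermE q m c : lterm q m c = msum (rterm c m) q.
Proof. by []. Qed.

Let pmul_msum p q : pmul p q = msum (lterm q) p.
Proof. by []. Qed.

Lemma pmull_sum q (I : Type) (s : seq I) (P : pred I) (F : I -> poly) :
  pmul (\sum_(x <- s | P x) F x) q = \sum_(x <- s | P x) pmul (F x) q.
Proof. by rewrite pmul_msum (msum_sum (@ltermD q)). Qed.

Lemma pmulr_sum p (I : Type) (s : seq I) (P : pred I) (F : I -> poly) :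
  pmul p (\sum_(x <- s | P x) F x) = \sum_(x <- s | P x) pmul p (F x).
Proof.
rewrite pmul_msum /msum.
under eq_bigr => m _ do rewrite ltermE (msum_sum (@rtermD p@_m m)).
exact: exchange_big.
Qed.

Lemma pmulUU a b m n :
  pmul << a *g m >> << b *g n >> = << a * b *g mmul m n >> :> poly.
Proof.
by rewrite pmul_msum (msumU (@ltermD _)) ltermE (msumU (@rtermD a m)).
Qed.

Lemma erase_varE i m j : erase_var i m j = (if j == i then 0 else m j)%N.
Proof.
rewrite /erase_var /cmonom_of_fsfun unlock /= fsfunE.
by case: mdomP => // _; rewrite if_same.
Qed.

Lemma expcmnE i e j : expcmn (ucm i) e j = ((i == j) * e)%N.
Proof.
case: e => [|e]; rewrite /expcmn /iterop ?onecmE ?muln0 //=.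
by elim: e => [|e IHe]; rewrite /= ?mulcmE ucmE ?muln1 // IHe [RHS]mulnS.
Qed.

(** Degree bounds become vanishing of coefficients, a form that passes through sums and
    differences. *)
Lemma deg_in_leP i p n :
  reflect (forall m, (n < m i)%N -> p@_m = 0) (deg_in i p <= n)%N.
Proof.
apply: (iffP (bigmax_leqP_seq _ _ _ _)) => [le_n m n_lt|p0 m mp _].
  apply/eqP; rewrite mcoeff_eq0; apply: contraL n_lt => /le_n.
  by rewrite leqNgt => ->.
by rewrite leqNgt; apply: contraL mp => /p0/eqP; rewrite mcoeff_eq0.
Qed.

Lemma deg_in0 i : deg_in i (0 : poly) = 0%N.
Proof. by rewrite /deg_in msupp0 big_seq_fset0. Qed.

Lemma leq_deg_in i p m : m \in msupp p -> (m i <= deg_in i p)%N.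
Proof. by move=> mp; apply: leq_bigmax_seq. Qed.

Lemma deg_inB i p q n :
  (deg_in i p <= n -> deg_in i q <= n -> deg_in i (p - q) <= n)%N.
Proof.
move=> /deg_in_leP p0 /deg_in_leP q0; apply/deg_in_leP => m n_lt.
by rewrite mcoeffB p0 ?q0 ?subrr.
Qed.

Lemma deg_in_sum i (I : eqType) (s : seq I) (P : pred I) (F : I -> poly) n :
  (forall x, x \in s -> P x -> deg_in i (F x) <= n)%N ->
  (deg_in i (\sum_(x <- s | P x) F x)%R <= n)%N.
Proof.
move=> F_le; apply/deg_in_leP => m n_lt; rewrite raddf_sum big_seq_cond big1 //.
by move=> x /andP[xs Px]; apply/deg_in_leP: n_lt; apply: F_le.
Qed.

Lemma deg_inU i m (c : R) : (deg_in i << c *g m >> <= m i)%N.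
Proof.
apply/deg_in_leP => k; rewrite mcoeffU; case: eqP => // ->.
by rewrite ltnn.
Qed.

Lemma pmul_init_in i f r :
  pmul (init_in i f) r = \sum_(m <- msupp f | m i == deg_in i f)
    \sum_(n <- msupp r) << f@_m * r@_n *g mmul (erase_var i m) n >>.
Proof.
rewrite {1}/init_in pmull_sum; apply: eq_bigr => m _.
by rewrite {1}[r]monalgE pmulr_sum; apply: eq_bigr => n _; rewrite pmulUU.
Qed.

Lemma pmul_init_in_X i f r k :
  pmul (pmul (init_in i r) << (1 : R) *g k >>) f =
  \sum_(n <- msupp r | n i == deg_in i r)
    \sum_(m <- msupp f)
      << r@_n * f@_m *g mmul (mmul (erase_var i n) k) m >>.
Proof.
rewrite [pmul (init_in i r) _]pmull_sum pmull_sum; apply: eq_bigr => n _.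
rewrite pmulUU {1}[f]monalgE pmulr_sum; apply: eq_bigr => m _.
by rewrite pmulUU mulr1.
Qed.

Lemma main_var_Some f i : main_var f = Some i ->
  (0 < deg_in i f)%N /\ forall j, (i < j)%O -> deg_in j f = 0%N.
Proof.
rewrite /main_var; case: pickP => // k /andP[/hasP[m mf mk] /forallP max_k].
case=> <-.
split=> [|j kj]; first by apply: leq_trans (leq_deg_in k mf); rewrite lt0n.
apply/eqP; rewrite -leqn0; apply/deg_in_leP => n n_gt; apply/eqP.
rewrite mcoeff_eq0; apply: contraTN kj => nf; rewrite -leNgt.
apply: (implyP (max_k j)); apply/hasP; exists n => //=.
by rewrite -lt0n.
Qed.

Section PseudoDivision.
Context (f : poly) (i : sigma).
Hypothesis fi : main_var f = Some i.

Lemma pdiv_stepE r : pdiv_step i f r =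
  \sum_(m <- msupp f | m i == deg_in i f)
    \sum_(n <- msupp r) << f@_m * r@_n *g mmul (erase_var i m) n >>
  - \sum_(n <- msupp r | n i == deg_in i r)
      \sum_(m <- msupp f) << r@_n * f@_m *g
        mmul (mmul (erase_var i n) (expcmn (ucm i) (deg_in i r - deg_in i f)))
             m >>.
Proof.
rewrite /pdiv_step /init fi.
exact (f_equal2 (fun p q : poly => p - q) (pmul_init_in i f r)
  (pmul_init_in_X i f r (expcmn (ucm i) (deg_in i r - deg_in i f)))).
Qed.

Lemma deg_pdiv_step_lt r : (deg_in i f <= deg_in i r)%N ->
  (deg_in i (pdiv_step i f r) < deg_in i r)%N.
Proof.
move=> le_fr; have [f_gt0 _] := main_var_Some fi.
have r_gt0 := leq_trans f_gt0 le_fr.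
rewrite -(prednK r_gt0) ltnS; apply/deg_in_leP => k.
rewrite (prednK r_gt0) => k_ge.
rewrite pdiv_stepE mcoeffB.
(* In degree at least deg_in i r, only the pairs of leading terms contribute  *)
(* to the two products, and they contribute the same terms.                   *)
apply/eqP; rewrite subr_eq0; apply/eqP.
have lead (T : R) p m n : n \in msupp p -> n i != deg_in i p -> m i = n i ->
    (deg_in i p <= k i)%N -> T *+ (m == k) = 0.
  move=> np n_ne mn p_le; case: eqP => // mk; case/negP: n_ne.
  by rewrite eqn_leq leq_deg_in //= -mn mk.
transitivity (\sum_(m <- msupp f | m i == deg_in i f)
   \sum_(n <- msupp r | n i == deg_in i r)
     << f@_m * r@_n *g mmul (erase_var i m) n >>@_k).
  rewrite raddf_sum; apply: eq_bigr => m _.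
  rewrite raddf_sum [RHS]big_mkcond !big_seq /=; apply: eq_bigr => n nr.
  case: ifPn => // n_ne; rewrite mcoeffU (lead _ _ _ _ nr) //.
  by rewrite cmM erase_varE eqxx.
rewrite raddf_sum exchange_big; apply: eq_bigr => n /eqP n_eq.
rewrite raddf_sum [LHS]big_mkcond !big_seq /=; apply: eq_bigr => m mf.
case: ifPn => [/eqP m_eq|m_ne].
  rewrite [LHS]mcoeffU [RHS]mcoeffU.
  (* The two monomials agree: for [j = i] both exponents are [deg_in i r], and elsewhere they differ
     only by the order of addition. *)
  rewrite mulrC; congr (_ *+ (_ == _)); apply/eqP/cmP => j.
  rewrite !cmM !erase_varE expcmnE [i == j]eq_sym.
  case: eqP => [->|_].
    by rewrite n_eq m_eq mul1n add0n subnK.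
  by rewrite mul0n addn0 addnC.
(* Here the exponent of X_i is [deg_in i r - deg_in i f + m i], so reaching [deg_in i r] forces [m]
   to be leading in [f]. *)
rewrite mcoeffU; case: eqP => // mk; case/negP: m_ne.
rewrite eqn_leq leq_deg_in //=.
move: k_ge; rewrite -mk !cmM erase_varE expcmnE !eqxx mul1n add0n.
by rewrite -{1}(subnK le_fr) leq_add2l.
Qed.

(** Above its main variable [f] has degree 0, and so does its initial; multiplying by either cannot
    raise the degree in X_j. *)
Lemma deg_pdiv_step_le j r : (i < j)%O ->
  (deg_in j (pdiv_step i f r) <= deg_in j r)%N.
Proof.
move=> ij; have [_ /(_ j ij) fj] := main_var_Some fi.
have f0 m : m \in msupp f -> m j = 0%N.
  by move/(leq_deg_in j); rewrite fj leqn0 => /eqP.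
rewrite pdiv_stepE.
apply: deg_inB; apply: deg_in_sum => m ms _; apply: deg_in_sum => n ns _;
  apply: leq_trans (deg_inU _ _ _) _; rewrite !cmM erase_varE (gt_eqF ij).
  by rewrite f0 // leq_deg_in.
by rewrite expcmnE (lt_eqF ij) mul0n (f0 n) // !addn0 leq_deg_in.
Qed.

Let step r := if (deg_in i f <= deg_in i r)%N then pdiv_step i f r else r.

Lemma deg_remdr_lt g : (deg_in i (remdr g f) < deg_in i f)%N.
Proof.
rewrite /remdr fi -/step.
(* Each effective iteration costs at least one degree; at [k = (deg_in i g).+1] the second
   alternative is impossible. *)
have: forall k, let r := iter k step g in
    (deg_in i r < deg_in i f)%N \/ (deg_in i r + k <= deg_in i g)%N.
  elim=> [|k /=]; first by right; rewrite addn0.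
  move: (iter k step g) => r IHk; rewrite /step.
  have [lt_f|ge_f] := ltnP (deg_in i r) (deg_in i f).
    by left.
  case: IHk => [|le_g]; first by rewrite ltnNge ge_f.
  right; rewrite addnS (leq_trans _ le_g) // ltn_add2r.
  exact: deg_pdiv_step_lt.
move/(_ (deg_in i g).+1) => /= [] // /(leq_trans (leq_addl _ _)).
by rewrite ltnn.
Qed.

Lemma deg_remdr_le j g : (i < j)%O -> (deg_in j (remdr g f) <= deg_in j g)%N.
Proof.
move=> ij; rewrite /remdr fi; elim: (deg_in i g).+1 => //= k IHk.
by case: ifP => // _; apply: leq_trans (deg_pdiv_step_le _ ij) IHk.
Qed.

End PseudoDivision.

Lemma var_lt_trans : transitive (@var_lt d sigma).
Proof. by move=> [b|] [a|] [c|] //=; apply: lt_trans. Qed.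

Lemma reduced0 p : reduced 0 p.
Proof. by rewrite /reduced eqxx. Qed.

(** The head of [S] divides last and has the lowest main variable, so its division preserves the
    degree bounds obtained from the later elements. *)
Lemma reduced_remdr_seq g S s : triangular S -> s \in S ->
  reduced (remdr_seq g S) s.
Proof.
case/andP => _; elim: S => // t S IHS /= pS.
have ltS: all (fun u => var_lt (main_var t) (main_var u)) S.
  by apply: order_path_min pS => ? ? ?; apply: var_lt_trans.
case ti: (main_var t) => [i|]; last by rewrite /remdr ti reduced0.
rewrite inE => /predU1P[->|sS].
  by rewrite /reduced /main_deg ti deg_remdr_lt ?orbT.
have := allP ltS s sS; rewrite ti; case sj: (main_var s) => [j|] //= ij.
have [s_gt0 _] := main_var_Some sj.
rewrite /reduced /main_deg sj; apply/orP; right.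
apply: leq_ltn_trans (deg_remdr_le ti _ ij) _.
(* The inner remainder may be 0; its degree 0 is then below that of [s], which is positive by
   [s_gt0]. *)
have := IHS (path_sorted pS) sS; rewrite /reduced /main_deg sj.
by case/predU1P => [->|//]; rewrite deg_in0.
Qed.

End Reduction.

(** * Lexicographic order on sequences of bounded length *)

Section Wellfoundedness.
Implicit Types s t : seqlexi nat.

Lemma ltxi_nat_cons a b s t :
  (a :: s < b :: t :> seqlexi nat)%O = (a < b)%N || (a == b) && (s < t)%O.
Proof. by rewrite ltxi_cons !leEnat; case: ltngtP. Qed.

(** Nested induction on the length bound, the head and the accessible tail. The bound is essential:
    [[1] > [0; 1] > [0; 0; 1] > ...] descends forever. *)
Lemma seqlexi_bounded_wf n s : (size s <= n)%N ->
  Acc (fun t u : seqlexi nat => (size t <= n)%N && (t < u)%O) s.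
Proof.
have acc0 m : Acc (fun t u : seqlexi nat => (size t <= m)%N && (t < u)%O) [::].
  by constructor=> t; rewrite ltxis0 andbF.
elim: n s => [|n IHn] [|a s]; [move=> _|by []|move=> _|]; try exact: acc0.
rewrite /= ltnS.
elim/ltn_ind: a s => a IHa s s_le.
have accs := IHn s s_le; elim: accs s_le => {}s _ IHs s_le.
constructor=> -[_|b t].
  exact: acc0.
rewrite ltxi_nat_cons /= ltnS => /andP[t_le /orP[ba|/andP[/eqP-> ts]]].
  exact: IHa.
by apply: IHs => //; rewrite t_le.
Qed.

End Wellfoundedness.

(** * Order on triangular sets, and existence of basic sets *)

Section BasicSets.
Context {d : Order.disp_t} {sigma : finOrderType d} {R : comPzRingType}.
Local Notation poly := {malg R[{cmonom sigma}]}.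
Implicit Types (p q f g r : poly) (S T B : seq poly) (a b : option sigma).

(** The count includes the variable itself, so ranks of variables are positive and 0 is left for
    [None]. *)
Definition var_rank a : nat :=
  if a is Some i then #|[pred j | (j <= i)%O]| else 0%N.

Lemma var_rank_le a : (var_rank a <= #|sigma|)%N.
Proof. by case: a => //= i; apply: max_card. Qed.

Lemma var_ltE a b : var_lt a b = (var_rank a < var_rank b)%N.
Proof.
have mono (i j : sigma) : (i < j)%O ->
    (#|[pred k | (k <= i)%O]| < #|[pred k | (k <= j)%O]|)%N.
  move=> ij; apply: proper_card; apply/properP; split.
    by apply/subsetP => k; rewrite !inE => /le_trans; apply; apply: ltW.
  by exists j; rewrite !inE ?lexx // -ltNge.
case: a b => [i|] [j|] //=; last first.
  by symmetry; apply/card_gt0P; exists j; rewrite inE lexx.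
by case: ltgtP => [/mono->|/mono/ltnW|->] //; rewrite ?ltnn // leqNgt => /negbTE.
Qed.

Lemma var_rank_inj : injective var_rank.
Proof.
move=> a b ab; have: ~~ var_lt a b && ~~ var_lt b a by rewrite !var_ltE ab ltnn.
by case: a b {ab} => [i|] [j|] //=; case: ltgtP => // ->.
Qed.

(* The final entry exceeds every variable rank, so that, as in tri_lt, a      *)
(* proper prefix of S comes after S.                                          *)
Definition profile S : seqlexi nat :=
  foldr (fun p s => [:: var_rank (main_var p), main_deg p & s])
    [:: #|sigma|.+1] S.

Lemma poly_ltE p q : poly_lt p q =
  (var_rank (main_var p) < var_rank (main_var q))%N
  || (var_rank (main_var p) == var_rank (main_var q))
     && (main_deg p < main_deg q)%N.
Proof. by rewrite /poly_lt var_ltE (inj_eq var_rank_inj). Qed.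

Lemma poly_simE p q : poly_sim p q =
  (var_rank (main_var p) == var_rank (main_var q))
  && (main_deg p == main_deg q).
Proof.
rewrite /poly_sim !poly_ltE; case: ltngtP => //= _.
by case: ltngtP.
Qed.

Lemma tri_ltE S T : tri_lt S T <-> (profile S < profile T)%O.
Proof.
elim: S T => [|p S IH] [|q T].
- rewrite ltxx; split=> // -[[k []]|[]] //.
- rewrite /= ltxi_nat_cons ltnNge leqW ?var_rank_le //=.
  rewrite gtn_eqF ?ltnS ?var_rank_le //.
  by split=> // -[[k []]|[]] //=; rewrite min0n.
- rewrite /= ltxi_nat_cons ltnS var_rank_le; split=> // _.
  by right; split.
rewrite /= !ltxi_nat_cons; split.
  case=> [[[|k] [k_lt sim lt_k]]|[sz sim]].
  - by move: lt_k; rewrite /= poly_ltE => /orP[->|/andP[-> ->]]; rewrite ?orbT.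
  - have /IH -> : tri_lt S T.
      left; exists k; split=> //; first by move: k_lt; rewrite /= minnSS ltnS.
      by move=> l lk; apply: (sim l.+1).
    have := sim 0%N isT; rewrite /= poly_simE => /andP[-> ->].
    by rewrite !orbT.
  have /IH -> : tri_lt S T by right; split=> // l lT; apply: (sim l.+1).
  have := sim 0%N isT; rewrite /= poly_simE => /andP[-> ->].
  by rewrite !orbT.
move=> lt_pq; have: poly_lt p q \/ poly_sim p q /\ (profile S < profile T)%O.
  move: lt_pq; rewrite poly_ltE poly_simE; case: ltngtP => //= _; first by left.
  by case: ltngtP => //= _; [left|right].
case=> [pq|[pq /IH[]]].
- by left; exists 0%N; split=> //; rewrite leq_min.
- case=> k [k_lt sim lt_k]; left; exists k.+1.
  by split=> [|[|l]|//]; rewrite ?minnSS //; apply: sim.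
- by case=> sz sim; right; split=> // -[|l] //; apply: sim.
Qed.

(** The lexicographic order is total, so incomparable sets have equal profiles. *)
Lemma tri_leE S T : tri_le S T <-> (profile S <= profile T)%O.
Proof.
rewrite /tri_le /tri_sim !tri_ltE; split.
  by case: ltgtP => // _ [|[]].
by rewrite le_eqVlt => /predU1P[->|]; [right; rewrite ltxx|left].
Qed.

(** The main variables are distinct elements of [option sigma]. *)
Lemma triangular_size S : triangular S -> (size S <= #|sigma|.+1)%N.
Proof.
move=> /andP[_ srt]; rewrite -(size_map main_var) -card_option.
have /card_uniqP <- : uniq (map main_var S); last exact: max_card.
apply: (@sorted_uniq _ (@var_lt d sigma)).
- exact: var_lt_trans.
- by case=> //= i; apply: ltxx.
- by rewrite sorted_map.
Qed.

Lemma size_profile S : size (profile S) = (size S).*2.+1.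
Proof. by elim: S => //= p S ->. Qed.

Lemma tri_lt_wf S : Acc (fun S T => ascending S /\ tri_lt S T) S.
Proof.
pose N := (#|sigma|.+1).*2.+1.
have size_le T : ascending T -> (size (profile T) <= N)%N.
  by case/andP=> /triangular_size T_le _; rewrite size_profile ltnS leq_double.
have acc_profile s :
    Acc (fun t u : seqlexi nat => (size t <= N)%N && (t < u)%O) s ->
    forall T, profile T = s -> Acc (fun S T => ascending S /\ tri_lt S T) T.
  elim=> {}s _ IHs T defs; constructor=> U [ascU /tri_ltE UT].
  by apply: IHs (erefl _); rewrite size_le // -defs.
(* [S] need not be ascending, so its profile may be longer than [N]; the bound holds from the first
   descent on. *)
constructor=> T [ascT _]; apply: acc_profile (erefl _).
exact/seqlexi_bounded_wf/size_le.
Qed.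

Lemma basic_set_exists (P : {fset poly}) : exists B, basic_set P B.
Proof.
suff min S : ascending S -> {subset S <= P} -> exists B, basic_set P B.
  (* The empty set is ascending and contained in any [P], so the descent has a starting point. *)
  by apply: (min [::]).
elim: (tri_lt_wf S) => {}S _ IHS ascS SP.
have [[T [ascT TP TS]]|no_lt] :=
    classic (exists T, [/\ ascending T, {subset T <= P} & tri_lt T S]).
  exact: (IHS T).
exists S; split=> // T ascT TP; apply/tri_leE; rewrite leNgt.
by apply/negP => /tri_ltE TS; apply: no_lt; exists T.
Qed.

(** Cut [B] at its first element whose main variable is not below that of [r], and put [r] there. *)
Lemma ascending_insert B r : ascending B -> r != 0 ->
  (forall s, s \in B -> reduced r s) ->
  exists S, [/\ ascending S, {subset S <= r :: B} & tri_lt S B].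
Proof.
move=> /andP[/andP[nzB srtB] redB] r_neq0 red_r.
pose below (s : poly) := var_lt (main_var s) (main_var r).
pose k := find (predC below) B.
have k_le : (k <= size B)%N by apply: find_size.
have belowk s : s \in take k B -> below s.
  move=> /(nthP 0)[l]; rewrite size_takel // => lk <-.
  by rewrite nth_take //; have := before_find 0 lk; move/negbFE.
exists (rcons (take k B) r); split.
- rewrite /ascending /triangular all_rcons r_neq0 /=.
  have -> /= : all (fun p : poly => p != 0) (take k B).
    by apply/allP => s /mem_take; apply: (allP nzB).
  have lt_trans: transitive (relpre main_var (@var_lt d sigma) : rel poly).
    by move=> ? ? ?; apply: var_lt_trans.
  move: srtB; rewrite !sorted_pairwise // !pairwise_rcons => srtB.
  rewrite !(subseq_pairwise (take_subseq _ _)) // !andbT.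
  apply/andP; split; apply/allP => s sB; first exact: belowk.
  exact/red_r/mem_take/sB.
- move=> s; rewrite mem_rcons !inE => /orP[->//|/mem_take ->].
  by rewrite orbT.
have nthk l : (l < k)%N -> (rcons (take k B) r)`_l = B`_l.
  by move=> lk; rewrite nth_rcons size_takel // lk nth_take.
have sim l : (l < k)%N -> poly_sim (rcons (take k B) r)`_l B`_l.
  by move=> lk; rewrite nthk // poly_simE !eqxx.
(* If nothing is cut off, the new set properly extends [B], and extensions are smaller. *)
have [k_lt|k_ge] := ltnP k (size B); last first.
  right; have k_eq: k = size B by apply/eqP; rewrite eqn_leq k_le.
  by rewrite size_rcons size_takel // -k_eq.
left; exists k; rewrite size_rcons size_takel // leq_min ltnSn; split=> //.
rewrite nth_rcons size_takel // ltnn eqxx.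
have: ~~ below B`_k by apply: (@nth_find _ 0 (predC below)); rewrite has_find.
have := red_r _ (mem_nth 0 k_lt); rewrite /reduced (negbTE r_neq0) /=.
rewrite /below var_ltE -leqNgt leq_eqVlt poly_ltE => deg_lt.
case/orP => [/eqP/var_rank_inj eq_r|->] //.
rewrite eq_r eqxx [main_deg r]/main_deg eq_r.
by case: (main_var B`_k) deg_lt => [i ->|//]; rewrite orbT.
Qed.

End BasicSets.

(** * Zeros of pseudo-remainders *)

Section Evaluation.
Context {d : Order.disp_t} {sigma : finOrderType d} {R K : comPzRingType}.
Context (iota : {rmorphism R -> K}) (x : sigma -> K).
Local Notation poly := {malg R[{cmonom sigma}]}.
Implicit Types (p q f g r : poly) (S : seq poly) (m : {cmonom sigma}).

Let term m (c : R) : K := iota c * \prod_(i : sigma) x i ^+ m i.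

Let termD m : {morph term m : a b / a + b}.
Proof. by move=> a b; rewrite /term rmorphD mulrDl. Qed.

Let peval_msum p : peval iota x p = msum term p.
Proof. by []. Qed.

Lemma peval0 : peval iota x 0 = 0.
Proof. exact: (msum0 term). Qed.

Lemma pevalB : {morph peval iota x : p q / p - q}.
Proof. exact: (msumB termD). Qed.

Lemma pevalM : {morph peval iota x : p q / pmul p q >-> p * q}.
Proof.
move=> p q; rewrite peval_msum /pmul (msum_sum termD).
under eq_bigr => m _ do rewrite (msum_sum termD).
rewrite /peval mulr_suml; apply: eq_bigr => m _.
rewrite mulr_sumr; apply: eq_bigr => n _.
rewrite (msumU termD) /term rmorphM mulrACA -big_split /=.
by congr (_ * _); apply: eq_bigr => i _; rewrite cmM exprD.
Qed.

(** Each step replaces the remainder by a polynomial combination of itself and [f], so common zeros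
    persist. *)
Lemma peval_remdr g f : peval iota x g = 0 -> peval iota x f = 0 ->
  peval iota x (remdr g f) = 0.
Proof.
move=> g0 f0; rewrite /remdr; case: main_var => [i|]; last exact: peval0.
elim: (deg_in i g).+1 => //= k; move: (iter _ _ _) => r r0.
have mul0 p q : peval iota x q = 0 -> peval iota x (pmul p q) = 0.
  by move=> q0; rewrite pevalM q0 mulr0.
have sub0 p q :
    peval iota x p = 0 -> peval iota x q = 0 -> peval iota x (p - q) = 0.
  by move=> p0 q0; rewrite pevalB p0 q0 subrr.
by case: ifP => // _; apply: sub0; apply: mul0.
Qed.

Lemma peval_remdr_seq g S : peval iota x g = 0 ->
  (forall s, s \in S -> peval iota x s = 0) -> peval iota x (remdr_seq g S) = 0.
Proof.
move=> g0; elim: S => //= s S IHS S0; apply: peval_remdr.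
  by apply: IHS => t tS; apply: S0; rewrite inE tS orbT.
by apply: S0; rewrite mem_head.
Qed.

End Evaluation.

(** * Termination and correctness of the loop *)

Section Algorithm.
Context {d : Order.disp_t} {sigma : finOrderType d} {R : comPzRingType}.
Local Notation poly := {malg R[{cmonom sigma}]}.
Implicit Types (PS P Q : {fset poly}) (B C : seq poly).

Lemma remaindersP P B r : reflect
  (r != 0 /\ exists2 p, p \in P & r = remdr_seq p B) (r \in remainders P B).
Proof.
rewrite in_fsetD1; apply: (iffP andP) => -[r0 pr]; split=> //.
  by case/imfsetP: pr => p; exists p.
by apply/imfsetP; case: pr => p; exists p.
Qed.

Lemma in_fsetUUseq P Q B r :
  (r \in P `|` Q `|` [fset b in B]) = [|| r \in P, r \in Q | r \in B].
Proof. by rewrite !inE orbA. Qed.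

(** The pass may have used a basic set [B'] of [P] other than [B]; minimality of both [C] and [B']
    gives the chain C ≤ T < B' ≤ B, where [T] is [B'] lowered by a remainder. *)
Lemma cs_step_tri_lt PS P Q B C :
  basic_set P B -> cs_step PS P Q -> basic_set Q C -> tri_lt C B.
Proof.
move=> [ascB BP minB] [B' [[ascB' B'P minB'] /fset0Pn[r rem_r] defQ]] [_ _ minC].
have [r0 [p _ defr]] := remaindersP _ _ _ rem_r.
have triB' : triangular B' by case/andP: ascB'.
have [|T [ascT TrB' TB']] := ascending_insert ascB' r0.
  by move=> s; rewrite defr; apply: reduced_remdr_seq.
have TQ : {subset T <= Q}.
  move=> t /TrB'; rewrite inE defQ in_fsetUUseq => /predU1P[->|->].
    by rewrite rem_r orbT.
  by rewrite !orbT.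
have /tri_leE CT := minC T ascT TQ; have /tri_leE B'B := minB' B ascB BP.
move/tri_ltE: TB' => TB'; apply/tri_ltE.
exact: le_lt_trans CT (lt_le_trans TB' B'B).
Qed.

(** Any basic set of the current [P] serves as the decreasing measure. *)
Lemma cs_step_acc PS P : Acc (fun Q P => cs_step PS P Q) P.
Proof.
have [B basicB] := basic_set_exists P.
elim: (tri_lt_wf B) P basicB => {}B _ IHB P basicB.
constructor=> Q PQ; have [C basicC] := basic_set_exists Q.
apply: (IHB C _ Q basicC); split; first by case: basicC.
exact: cs_step_tri_lt basicB PQ basicC.
Qed.

Lemma cs_reaches_returns PS P : cs_reaches PS P -> exists CS, cs_returns PS CS.
Proof.
elim: (cs_step_acc PS P) => {}P _ IHP reachP.
have [B basicB] := basic_set_exists P.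
have [rem0|rem_neq0] := eqVneq (remainders P B) fset0; first by exists B, P.
apply: (IHP (PS `|` remainders P B `|` [fset b in B])); first by exists B.
by apply: cs_loop reachP _; exists B.
Qed.

Lemma cs_reaches_sub PS P : cs_reaches PS P -> {subset PS <= P}.
Proof.
case=> // {}P Q _ [B [_ _ ->]] p pPS.
by rewrite in_fsetUUseq pPS.
Qed.

Lemma cs_reaches_zero (K : comPzRingType) (iota : {rmorphism R -> K}) PS P x :
  cs_reaches PS P -> is_zero iota [in PS] x -> is_zero iota [in P] x.
Proof.
move=> reachP PS0; elim: reachP => // {}P Q _ P0 [B [[_ BP _] _ ->]] q.
rewrite in_fsetUUseq => /or3P[/PS0 //|/remaindersP[_ [p pP ->]]|qB].
  by apply: peval_remdr_seq => [|s /BP]; apply: P0.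
by apply/P0/BP.
Qed.

End Algorithm.

Theorem theorem6 (d : Order.disp_t) (sigma : finOrderType d)
    (R K : comPzRingType) (iota : {rmorphism R -> K}%R)
    (PS : {fset {malg R[{cmonom sigma}]}}) :
  [/\ (* the loop terminates, whatever basic sets are chosen *)
      Acc (fun Q P => cs_step PS P Q) PS,
      (* step 2 can always be carried out *)
      forall P, cs_reaches PS P -> exists B, basic_set P B,
      (* the algorithm returns, and whatever it returns is correct *)
      exists CS, cs_returns PS CS
    & forall CS, cs_returns PS CS -> characteristic_set iota PS CS].
Proof.
split.
- exact: cs_step_acc.
- by move=> P _; apply: basic_set_exists.
- exact/cs_reaches_returns/cs_start.
move=> CS [P [reachP [ascCS CSP _] rem0]]; split.
- by case/andP: ascCS.
(* A nonzero remainder of [p] would belong to [remainders P CS], which is empty. *)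
- move=> p /(cs_reaches_sub reachP) pP; apply: contraTeq isT => r_neq0.
  have : remdr_seq p CS \in remainders P CS.
    by apply/remaindersP; split=> //; exists p.
  by rewrite rem0.
- by move=> x PS0 p /CSP; apply: (cs_reaches_zero reachP).
Qed.
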